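(* Let $R_1$ and $R_2$ be commutative rings with nonzero identity that are not fields, let $R=R_1\times R_2$, and let $I$ be a nonzero proper ideal of $R$. Then the following statements are equivalent. (1) $I$ is a weakly 1-absorbing primary ideal of $R$. (2) $I=I_1\times R_2$ for some primary ideal $I_1$ of $R_1$, or $I=R_1\times I_2$ for some primary ideal $I_2$ of $R_2$. (3) $I$ is a 1-absorbing primary ideal of $R$. (4) $I$ is a primary ideal of $R$.
   Context: All rings are commutative with $1\neq 0$. For an ideal $I$ of $R$, $\sqrt{I}=\{a\in R : a^n\in I \text{ for some positive integer } n\}$. A proper ideal $I$ of $R$ is called weakly 1-absorbing primary if whenever $a,b,c\in R$ are nonunit elements and $0\neq abc\in I$, then $ab\in I$ or $c\in\sqrt{I}$. A proper ideal $I$ of $R$ is called 1-absorbing primary if whenever $a,b,c\in R$ are nonunit elements and $abc\in I$, then $ab\in I$ or $c\in\sqrt{I}$. *)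

(* Defs.v *)
From HB Require Import structures.
From mathcomp Require Import all_boot all_algebra.
From mathcomp Require Import boolp classical_sets.

Set Implicit Arguments.
Unset Strict Implicit.
Unset Printing Implicit Defensive.

Import GRing.Theory.
Local Open Scope ring_scope.
Local Open Scope classical_set_scope.

(* The library's [GRing.unit] presupposes a decidable unit predicate
   ([unitRingType]); over an arbitrary commutative ring units are given by
   existence of an inverse. *)
Definition is_unit (R : comNzRingType) (a : R) : Prop := exists b, a * b = 1.

(* [1 != 0] is part of [comNzRingType]. *)
Definition is_field (R : comNzRingType) : Prop :=
  forall a : R, a != 0 -> is_unit a.

(* [idealr_closed] includes properness, as [1 \notin I]. *)
Definition is_proper_ideal (R : comNzRingType) (I : set R) : Prop :=
  idealr_closed (mem I).

Definition radical (R : comNzRingType) (I : set R) : set R :=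
  [set a | exists2 n, (0 < n)%N & I (a ^+ n)].

Definition is_primary_ideal (R : comNzRingType) (I : set R) : Prop :=
  is_proper_ideal I /\
  forall a b : R, I (a * b) -> I a \/ radical I b.

Definition is_weakly_1absorbing_primary_ideal
    (R : comNzRingType) (I : set R) : Prop :=
  is_proper_ideal I /\
  forall a b c : R, ~ is_unit a -> ~ is_unit b -> ~ is_unit c ->
    a * b * c != 0 -> I (a * b * c) -> I (a * b) \/ radical I c.

Definition is_1absorbing_primary_ideal
    (R : comNzRingType) (I : set R) : Prop :=
  is_proper_ideal I /\
  forall a b c : R, ~ is_unit a -> ~ is_unit b -> ~ is_unit c ->
    I (a * b * c) -> I (a * b) \/ radical I c.

(* Main.v *)
(* If (x, y) lies in I with x a nonzero nonunit, then (x, 0) = (1, 0)(1, 0)(x, 1)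
   is a nonzero product of nonunits, which forces (1, 0) or (0, 1) into I; so I
   contains a factor of the product, hence is I1 x R2 or R1 x I2. Since the
   other factor is not a field, nonzero nonunits in it turn the weak absorbing
   property of I into I1 or I2 being primary. *)
Require Import Defs.
From HB Require Import structures.
From mathcomp Require Import all_boot all_algebra.
From mathcomp Require Import boolp classical_sets.

Set Implicit Arguments.
Unset Strict Implicit.
Unset Printing Implicit Defensive.

Import GRing.Theory.
Local Open Scope ring_scope.
Local Open Scope classical_set_scope.

(** Unfolds the boolean membership of [idealr_closed] into propositions, the form in which ideals
    are handled below. *)
Lemma proper_idealP (R : comNzRingType) (I : set R) :
  is_proper_ideal I <->
  [/\ I 0, ~ I 1 & forall a u v, I u -> I v -> I (a * u + v)].
Proof.
split=> [[I0 I1 IM]|[I0 I1 IM]]; split.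
- exact: set_mem.
- by move=> /mem_set; apply/negP.
- by move=> a u v Iu Iv; apply: set_mem; apply: IM; exact: mem_set.
- exact: mem_set.
- by apply/negP => /set_mem.
- by move=> a u v /set_mem Iu /set_mem Iv; apply: mem_set; exact: IM.
Qed.

Lemma proper_idealMl (R : comNzRingType) (I : set R) (a u : R) :
  is_proper_ideal I -> I u -> I (a * u).
Proof.
by move=> /proper_idealP[I0 _ IM] Iu; rewrite -[a * u]addr0; exact: IM.
Qed.

Lemma proper_idealD (R : comNzRingType) (I : set R) (u v : R) :
  is_proper_ideal I -> I u -> I v -> I (u + v).
Proof.
by move=> /proper_idealP[_ _ IM] Iu Iv; rewrite -[u]mul1r; exact: IM.
Qed.

Lemma proper_ideal_preimage (R S : comNzRingType) (f : {rmorphism R -> S})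
    (I : set S) :
  is_proper_ideal I -> is_proper_ideal (f @^-1` I).
Proof.
move=> /proper_idealP[I0 I1 IM]; apply/proper_idealP; split=> /=.
- by rewrite rmorph0.
- by rewrite rmorph1.
- by move=> a u v Iu Iv; rewrite rmorphD rmorphM; exact: IM.
Qed.

Lemma primary_ideal_preimage (R S : comNzRingType) (f : {rmorphism R -> S})
    (I : set S) :
  is_primary_ideal I -> is_primary_ideal (f @^-1` I).
Proof.
move=> [idI prI]; split; first exact: proper_ideal_preimage.
move=> a b /=; rewrite rmorphM => /prI[|[n n0 In]]; first by left.
by right; exists n => //=; rewrite rmorphXn.
Qed.

(** The left inverse [g] serves twice: it carries an inverse of [f a] back to one of [a], so [f]
    preserves nonunits, and it makes [f] injective, so a nonzero product stays nonzero. *)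
Lemma weakly_1absorbing_primary_preimage (R S : comNzRingType)
    (f : {rmorphism R -> S}) (g : {rmorphism S -> R}) (I : set S) :
  cancel f g -> is_weakly_1absorbing_primary_ideal I ->
  is_weakly_1absorbing_primary_ideal (f @^-1` I).
Proof.
move=> fK [idI wI]; split; first exact: proper_ideal_preimage.
have unitf a : ~ is_unit a -> ~ is_unit (f a).
  move=> nua [b fab]; apply: nua; exists (g b).
  by rewrite -[a in LHS]fK -rmorphM fab rmorph1.
move=> a b c /unitf nua /unitf nub /unitf nuc abc0 /=.
rewrite !rmorphM => Iabc.
have fabc0 : f a * f b * f c != 0.
  by rewrite -!rmorphM -(rmorph0 f) (can_eq fK).
have [|[n n0 In]] := wI _ _ _ nua nub nuc fabc0 Iabc; first by left.
by right; exists n => //=; rewrite rmorphXn.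
Qed.

Lemma primary_is_1absorbing_primary (R : comNzRingType) (I : set R) :
  is_primary_ideal I -> is_1absorbing_primary_ideal I.
Proof. by move=> [idI prI]; split=> // a b c _ _ _; exact: prI. Qed.

Lemma is_1absorbing_primary_weakly (R : comNzRingType) (I : set R) :
  is_1absorbing_primary_ideal I -> is_weakly_1absorbing_primary_ideal I.
Proof. by move=> [idI absI]; split=> // a b c ua ub uc _; exact: absI. Qed.

(** The exchange isomorphism; pulling ideals back along it yields the statements about the second
    factor from those about the first. *)
Definition swap_pair (R1 R2 : comNzRingType) (x : R1 * R2) : R2 * R1 :=
  (x.2, x.1).

Fact swap_pair_is_zmod_morphism (R1 R2 : comNzRingType) :
  zmod_morphism (@swap_pair R1 R2).
Proof. by []. Qed.

Fact swap_pair_is_monoid_morphism (R1 R2 : comNzRingType) :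
  monoid_morphism (@swap_pair R1 R2).
Proof. by []. Qed.

HB.instance Definition _ (R1 R2 : comNzRingType) :=
  GRing.isZmodMorphism.Build _ _ (@swap_pair R1 R2)
    (@swap_pair_is_zmod_morphism R1 R2).
HB.instance Definition _ (R1 R2 : comNzRingType) :=
  GRing.isMonoidMorphism.Build _ _ (@swap_pair R1 R2)
    (@swap_pair_is_monoid_morphism R1 R2).

Lemma swap_pairK (R1 R2 : comNzRingType) :
  cancel (@swap_pair R1 R2) (@swap_pair R2 R1).
Proof. by case. Qed.

Lemma is_unit_pair (R1 R2 : comNzRingType) (x : R1) (y : R2) :
  is_unit ((x, y) : (R1 * R2)%type) -> is_unit x /\ is_unit y.
Proof. by move=> [[u v] [xu yv]]; split; [exists u|exists v]. Qed.

Lemma not_unit0 (R : comNzRingType) : ~ is_unit (0 : R).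
Proof. by move=> [b /eqP]; rewrite mul0r eq_sym oner_eq0. Qed.

Lemma mulr_pair (R1 R2 : comNzRingType) (x z : R1) (y t : R2) :
  ((x, y) : (R1 * R2)%type) * ((z, t) : (R1 * R2)%type) = (x * z, y * t).
Proof. by []. Qed.

Lemma addr_pair (R1 R2 : comNzRingType) (x z : R1) (y t : R2) :
  ((x, y) : (R1 * R2)%type) + ((z, t) : (R1 * R2)%type) = (x + z, y + t).
Proof. by []. Qed.

Lemma expr_pair (R1 R2 : comNzRingType) (x : R1) (y : R2) n :
  ((x, y) : (R1 * R2)%type) ^+ n = (x ^+ n, y ^+ n).
Proof. by elim: n => // n IHn; rewrite !exprS IHn. Qed.

Lemma not_is_field (R : comNzRingType) :
  ~ is_field R -> exists2 y : R, y != 0 & ~ is_unit y.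
Proof.
by move=> /existsNP[y /not_implyP[y0 nuy]]; exists y.
Qed.

Lemma weakly_1absorbing_primary_has_factor (R1 R2 : comNzRingType)
    (I : set (R1 * R2)%type) (x : R1) (y : R2) :
  is_weakly_1absorbing_primary_ideal I -> I (x, y) -> x != 0 ->
  I (1, 0) \/ I (0, 1).
Proof.
move=> [idI wI] Ixy x0.
have Ix0 : I (x, 0).
  by have := proper_idealMl (1, 0) idI Ixy; rewrite !mulr_pair mul1r mul0r.
(* A unit [x] gives [(1, 0)] at once, on multiplying [(x, 0)] by its inverse. *)
have [[z xz]|nux] := pselect (is_unit x).
  left; have := proper_idealMl (z, 0) idI Ix0.
  by rewrite !mulr_pair mul0r mulrC xz.
have nu10 : ~ is_unit ((1, 0) : (R1 * R2)%type).
  by move=> /is_unit_pair[_ /not_unit0].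
have nux1 : ~ is_unit ((x, 1) : (R1 * R2)%type) by move=> /is_unit_pair[].
have E : ((1, 0) * (1, 0) * (x, 1) : (R1 * R2)%type) = (x, 0).
  by rewrite !mulr_pair !mul1r !mul0r.
have [||I10|[n _ In]] := wI _ _ _ nu10 nu10 nux1.
- by rewrite E; apply: contra x0 => /eqP[->].
- by rewrite E.
- by left; move: I10; rewrite !mulr_pair mul1r mul0r.
(* Every power of [(x, 1)] has second coordinate [1], so multiplying it by [(0, 1)] leaves
   [(0, 1)]. *)
- right; have := proper_idealMl (0, 1) idI In.
  by rewrite expr_pair mulr_pair mul0r mul1r expr1n.
Qed.

(** Once [(0, 1)] lies in [I], membership depends on the first coordinate only, so [I] is determined
    by its slice at second coordinate [0]. *)
Lemma weakly_1absorbing_primary_setXT (R1 R2 : comNzRingType)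
    (I : set (R1 * R2)%type) :
  ~ is_field R2 -> is_weakly_1absorbing_primary_ideal I -> I (0, 1) ->
  exists I1 : set R1, is_primary_ideal I1 /\ I = I1 `*` [set: R2].
Proof.
move=> /not_is_field[y y0 nuy] [idI wI] I01.
have I0 z : I (0, z).
  by have := proper_idealMl (0, z) idI I01; rewrite !mulr_pair mul0r mulr1.
have Isnd x z z' : I (x, z) -> I (x, z').
  move=> /(proper_idealD idI)/(_ (I0 (z' - z))).
  by rewrite addr_pair addr0 addrC subrK.
exists [set x | I (x, 0)]; split; last first.
  by apply/seteqP; split=> -[x z] /=; [move=> /Isnd Ix|case=> /Isnd].
have idI1 : is_proper_ideal [set x | I (x, 0)].
  have /proper_idealP[I00 I11 IM] := idI.
  apply/proper_idealP; split=> //= [/Isnd/I11//|a u v Iu Iv].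
  by have := IM (a, 0) _ _ Iu Iv; apply: Isnd.
split=> // a b /= Iab.
(* The absorbing property concerns nonunits only, so units [a] or [b] are cancelled from the product
   first. *)
have [[a' aa']|nua] := pselect (is_unit a).
  right; exists 1%N => //=; rewrite expr1.
  have := proper_idealMl a' idI1 Iab.
  by rewrite mulrA [a' * a]mulrC aa' mul1r.
have [[b' bb']|nub] := pselect (is_unit b).
  by left; have := proper_idealMl b' idI1 Iab; rewrite mulrC -mulrA bb' mulr1.
(* The nonzero nonunit [y] makes [(a, 1) * (1, y) * (b, 1) = (ab, y)] a nonzero
   product of nonunits even when [ab = 0]. *)
have E : ((a, 1) * (1, y) * (b, 1) : (R1 * R2)%type) = (a * b, y).
  by rewrite !mulr_pair !mulr1 mul1r.
have [|||||In|[n n0 In]] := wI (a, 1) (1, y) (b, 1).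
- by move=> /is_unit_pair[].
- by move=> /is_unit_pair[].
- by move=> /is_unit_pair[].
- by rewrite E; apply: contra y0 => /eqP[_ ->].
- by rewrite E; exact: Isnd Iab.
- by left; move: In; rewrite !mulr_pair mulr1; exact: Isnd.
- by right; exists n => //=; move: In; rewrite expr_pair; exact: Isnd.
Qed.

Lemma weakly_1absorbing_primary_prod (R1 R2 : comNzRingType)
    (I : set (R1 * R2)%type) :
  ~ is_field R1 -> ~ is_field R2 -> I <> [set 0] ->
  is_weakly_1absorbing_primary_ideal I ->
  (exists I1 : set R1, is_primary_ideal I1 /\ I = I1 `*` [set: R2]) \/
  (exists I2 : set R2, is_primary_ideal I2 /\ I = [set: R1] `*` I2).
Proof.
move=> nF1 nF2 In0 wI.
(* The ideal [I] with its factors exchanged, for use when the second coordinate is the nonzero one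
   or when [(1, 0)] lies in [I]. *)
have wJ : is_weakly_1absorbing_primary_ideal (@swap_pair R2 R1 @^-1` I).
  exact: weakly_1absorbing_primary_preimage (@swap_pairK R2 R1) wI.
have [[x z] Ixz xz0] : exists2 p, I p & p != 0.
  apply: contrapT => noI; apply: In0; apply/seteqP; split=> [p Ip|p ->] /=.
    by apply/eqP; apply: contrapT => /negP p0; apply: noI; exists p.
  by have [/proper_idealP[]] := wI.
have {x z Ixz xz0} [I10|I01] : I (1, 0) \/ I (0, 1).
  have [x0|x0] := eqVneq x 0; last first.
    exact: weakly_1absorbing_primary_has_factor wI Ixz x0.
  have z0 : z != 0 by apply: contra xz0 => /eqP ->; rewrite x0.
  by rewrite orC; exact: weakly_1absorbing_primary_has_factor wJ Ixz z0.
(* By computation, [I10] also says that [(0, 1)] lies in the exchanged ideal; evaluating [JE] at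
   [(z, x)] then describes [I] at [(x, z)]. *)
- right; have [I2 [prI2 JE]] := weakly_1absorbing_primary_setXT nF1 wJ I10.
  exists I2; split=> //; rewrite setTX; apply/funext => -[x z].
  by move: JE; rewrite setXT => /(congr1 (@^~ (z, x))).
- by left; exact: weakly_1absorbing_primary_setXT nF2 wI I01.
Qed.

Theorem theorem13 (R1 R2 : comNzRingType)
    (hR1 : ~ is_field R1) (hR2 : ~ is_field R2)
    (I : set (R1 * R2)%type)
    (hI : is_proper_ideal I) (hI0 : I <> [set 0]) :
  [<-> is_weakly_1absorbing_primary_ideal I;
       (exists I1 : set R1, is_primary_ideal I1 /\ I = I1 `*` [set: R2]) \/
       (exists I2 : set R2, is_primary_ideal I2 /\ I = [set: R1] `*` I2);
       is_1absorbing_primary_ideal I;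
       is_primary_ideal I].
Proof.
have wP := weakly_1absorbing_primary_prod hR1 hR2 hI0.
have Pprimary :
    (exists I1 : set R1, is_primary_ideal I1 /\ I = I1 `*` [set: R2]) \/
    (exists I2 : set R2, is_primary_ideal I2 /\ I = [set: R1] `*` I2) ->
    is_primary_ideal I.
  move=> [[I1 [prI1 ->]]|[I2 [prI2 ->]]].
    (* A product with a full factor is the preimage of the other factor under a projection, which is
       a ring morphism. *)
    by rewrite setXT; exact: (primary_ideal_preimage fst).
  by rewrite setTX; exact: (primary_ideal_preimage snd).
tfae.
- exact: wP.
- by move=> /Pprimary/primary_is_1absorbing_primary.
(* The way to primary goes through the weak property and the product form. *)
- by move=> /is_1absorbing_primary_weakly/wP/Pprimary.
- by move=> /primary_is_1absorbing_primary/is_1absorbing_primary_weakly.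
Qed.
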